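(* For every $X\in ES$, the class of tree-like grand-coalition-first action $X$-models is $z$-representable by the class of tree-like single-coalition-first neighborhood $X$-models; that is, every tree-like grand-coalition-first action $X$-model is $z$-representable by some tree-like single-coalition-first neighborhood $X$-model, and every tree-like single-coalition-first neighborhood $X$-model $z$-represents some tree-like grand-coalition-first action $X$-model.
   Context: $AG$ is a finite nonempty set of agents, $AP$ a countable set of atomic propositions. For a nonempty set $AC$ and $C\subseteq AG$, $JA_C$ is the set of functions $\sigma_C:C\to AC$ ($JA_\emptyset=\{\emptyset\}$); $\sigma_C\subseteq\sigma_{AG}$ means $\sigma_C$ is the restriction of $\sigma_{AG}$ to $C$; for disjoint $C,D$, $\sigma_C\cup\sigma_D\in JA_{C\cup D}$. A grand-coalition-first action model is $M=(ST,AC,out_{AG},L)$ with $ST,AC$ nonempty, $out_{AG}:ST\times JA_{AG}\to\mathcal P(ST)$, $L:ST\to\mathcal P(AP)$. It determines $out_C(s,\sigma_C)=\bigcup\{out_{AG}(s,\sigma_{AG})\mid\sigma_C\subseteq\sigma_{AG}\}$, $av_C(s)=\{\sigma_C\mid out_C(s,\sigma_C)\neq\emptyset\}$, $AE_C(s)=\{out_C(s,\sigma_C)\mid\sigma_C\in av_C(s)\}$. $M$ is serial if $av_C(s)\neq\emptyset$ for all $C,s$; independent if for all $s$, disjoint $C,D$, $\sigma_C\in av_C(s)$, $\sigma_D\in av_D(s)$: $\sigma_C\cup\sigma_D\in av_{C\cup D}(s)$; deterministic if $out_{AG}(s,\sigma_{AG})$ is a singleton for all $s$ and $\sigma_{AG}\in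 av_{AG}(s)$. An $AG$-history from $s_0$ to $s_n$ is $(s_0)$ (from $s_0$ to $s_0$) or $(s_0,\sigma^1,s_1,\dots,\sigma^n,s_n)$, $n\ge1$, with $\sigma^{i+1}\in av_{AG}(s_i)$, $s_{i+1}\in out_{AG}(s_i,\sigma^{i+1})$; $M$ is tree-like if there is $r$ such that for every $s$ there is a unique $AG$-history from $r$ to $s$. A single-coalition-first neighborhood model is $N=(ST,suc,\{nei_a\}_{a\in AG},L)$ with $ST$ nonempty, $suc:ST\to\mathcal P(ST)$, $L:ST\to\mathcal P(AP)$, each $nei_a(s)\subseteq\mathcal P(ST)$ a cover of $suc(s)$ (union $suc(s)$, $\emptyset\notin nei_a(s)$). With $\Delta_1\odot\Delta_2=\{Y_1\cap Y_2\mid Y_i\in\Delta_i,Y_1\cap Y_2\neq\emptyset\}$ (extended to finitely many families, $\bigodot\{\Delta\}=\Delta$): $nei_C(s)=\emptyset$ if $suc(s)=\emptyset$; $\{suc(s)\}$ if $suc(s)\neq\emptyset$, $C=\emptyset$; $\bigodot\{nei_a(s)\mid a\in C\}$ otherwise. $N$ is serial if $nei_C(s)\neq\emptyset$ for all $C,s$; independent if for all $s$, disjoint $C,D$, $Y_1\in nei_C(s)$, $Y_2\in nei_D(s)$: $Y_1\cap Y_2\neq\emptyset$; deterministic if every $Y\in nei_{AG}(s)$ is a singleton. A $C$-history in $N$ from $s_0$ to $s_n$ is $(s_0)$ or $(s_0,Y_1,s_1,\dots,Y_n,s_n)$, $n\ge1$, with $Y_{i+1}\in nei_C(s_i)$,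 $s_{i+1}\in Y_{i+1}$; $N$ is tree-like if there is $r$ such that for every $a\in AG$ and $s$ there is a unique $\{a\}$-history from $r$ to $s$. $ES=\{\epsilon,\mathtt S,\mathtt I,\mathtt D,\mathtt{SI},\mathtt{SD},\mathtt{ID},\mathtt{SID}\}$; an $X$-model has the properties whose letters ($\mathtt S$ serial, $\mathtt I$ independent, $\mathtt D$ deterministic) occur in $X$. $M$ is $z$-representable by $N$ ($N$ $z$-represents $M$) if they share $ST$ and $L$ and $AE_C=nei_C$ for all $C\subseteq AG$. *)

(* Defs.v *)
From mathcomp Require Import all_boot.
From mathcomp Require Import boolp classical_sets.
Set Implicit Arguments.
Unset Strict Implicit.
Unset Printing Implicit Defensive.

Local Open Scope classical_set_scope.

(** * Joint actions *)

Section JointActions.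
Context {AG : finType} {AC : Type}.

Definition JA (C : {set AG}) : Type := {a : AG | a \in C} -> AC.

Definition JAG : Type := JA [set: AG]%SET.

Definition restr (C : {set AG}) (sAG : JAG) : JA C :=
  fun a => sAG (exist _ (val a) (finset.in_setT (val a))).

Lemma in_setU_r (C D : {set AG}) (a : AG) :
  a \in C :|: D -> ~ a \in C -> a \in D.
Proof. by rewrite inE => /orP[]. Qed.

(* Left-biased, so that it is total; only used for disjoint [C] and [D]. *)
Definition ja_union (C D : {set AG}) (sC : JA C) (sD : JA D) : JA (C :|: D) :=
  fun a => match @idP (val a \in C) with
           | ReflectT h => sC (exist _ (val a) h)
           | ReflectF h => sD (exist _ (val a) (in_setU_r (valP a) h))
           end.

End JointActions.

Arguments JA {AG} AC C.
Arguments JAG AG AC : clear implicits.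
Arguments restr {AG AC} C sAG.

(** * Histories *)

(* [history av res s h t]: the sequence [(s, x1, s1, ..., xn, sn)], where [h]
   is [(x1, s1), ..., (xn, sn)], is a history from [s] to [t] (so [sn = t], and
   [s = t] when [h] is empty); [av s] are the moves available at [s], and
   [res s x] is the set of states to which the move [x] may lead from [s]. *)
Fixpoint history (T A : Type) (av : T -> set A) (res : T -> A -> set T)
    (s : T) (h : seq (A * T)) (t : T) : Prop :=
  match h with
  | [::] => s = t
  | (x, s') :: h' => [/\ av s x, res s x s' & history av res s' h' t]
  end.

(** * Grand-coalition-first action models *)

(* The set of states is a parameter rather than a field, so that two models
   can share it. *)
Record action_model (AG : finType) (AP ST : Type) := ActionModel {
  am_AC : Type;
  am_ST_nonempty : inhabited ST;
  am_AC_nonempty : inhabited am_AC;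
  am_outAG : ST -> JAG AG am_AC -> set ST;
  am_L : ST -> set AP
}.

Section ActionModels.
Context {AG : finType} {AP ST : Type}.
Variable M : action_model AG AP ST.

Definition am_out (C : {set AG}) (s : ST) (sC : JA (am_AC M) C) : set ST :=
  \bigcup_(sAG in [set sAG : JAG AG (am_AC M) | sC = restr C sAG])
    am_outAG s sAG.

Definition am_av (C : {set AG}) (s : ST) : set (JA (am_AC M) C) :=
  [set sC | am_out s sC !=set0].

Arguments am_av C s _ : clear implicits.

Definition am_AE (C : {set AG}) (s : ST) : set (set ST) :=
  [set am_out s sC | sC in am_av C s].

Definition am_serial : Prop :=
  forall (C : {set AG}) (s : ST), am_av C s !=set0.

Definition am_independent : Prop :=
  forall (s : ST) (C D : {set AG}), [disjoint C & D]%B ->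
  forall (sC : JA (am_AC M) C) (sD : JA (am_AC M) D),
    am_av C s sC -> am_av D s sD -> am_av (C :|: D) s (ja_union sC sD).

Definition am_deterministic : Prop :=
  forall (s : ST) (sAG : JAG AG (am_AC M)),
    am_av [set: AG]%SET s sAG -> exists t : ST, am_outAG s sAG = [set t].

Definition am_history :
    ST -> seq (JAG AG (am_AC M) * ST) -> ST -> Prop :=
  history (am_av [set: AG]%SET) (@am_outAG _ _ _ M).

Definition am_treelike : Prop :=
  exists r : ST, forall s : ST, exists! h, am_history r h s.

End ActionModels.

(** * Single-coalition-first neighborhood models *)

Record nei_model (AG : finType) (AP ST : Type) := NeiModel {
  nm_ST_nonempty : inhabited ST;
  nm_suc : ST -> set ST;
  nm_nei : AG -> ST -> set (set ST);
  nm_L : ST -> set AP;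
  nm_cover : forall a s, \bigcup_(Y in nm_nei a s) Y = nm_suc s;
  nm_nei_neq0 : forall a s, ~ nm_nei a s set0
}.

Definition odot (T : Type) (D1 D2 : set (set T)) : set (set T) :=
  [set Y | Y !=set0 /\
           exists Y1 Y2, [/\ D1 Y1, D2 Y2 & Y = Y1 `&` Y2]].

(* [odot] is associative and commutative, so the order of the families is
   immaterial; repeated families are kept. The value on the empty sequence is
   arbitrary: it is never used below. *)
Definition bigodot (T : Type) (Ds : seq (set (set T))) : set (set T) :=
  match Ds with
  | [::] => set0
  | D :: Ds' => foldl (@odot T) D Ds'
  end.

Section NeighborhoodModels.
Context {AG : finType} {AP ST : Type}.
Variable N : nei_model AG AP ST.

Definition nm_neiC (C : {set AG}) (s : ST) : set (set ST) :=
  if `[< nm_suc N s = set0 >] then set0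
  else if C == finset.set0 then [set nm_suc N s]
  else bigodot [seq nm_nei N a s | a <- enum C].

Definition nm_serial : Prop :=
  forall (C : {set AG}) (s : ST), nm_neiC C s !=set0.

Definition nm_independent : Prop :=
  forall (s : ST) (C D : {set AG}), [disjoint C & D]%B ->
  forall Y1 Y2 : set ST,
    nm_neiC C s Y1 -> nm_neiC D s Y2 -> Y1 `&` Y2 !=set0.

Definition nm_deterministic : Prop :=
  forall (s : ST) (Y : set ST),
    nm_neiC [set: AG]%SET s Y -> exists t : ST, Y = [set t].

Definition nm_history (C : {set AG}) :
    ST -> seq (set ST * ST) -> ST -> Prop :=
  history (nm_neiC C) (fun _ Y => Y).

Definition nm_treelike : Prop :=
  exists r : ST, forall (a : AG) (s : ST),
    exists! h, nm_history [set a]%SET r h s.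

End NeighborhoodModels.

(** * X-models *)

Inductive letter := LS | LI | LD.

Inductive ES := X_eps | X_S | X_I | X_D | X_SI | X_SD | X_ID | X_SID.

Definition occurs (l : letter) (X : ES) : bool :=
  match l, X with
  | LS, (X_S | X_SI | X_SD | X_SID) => true
  | LI, (X_I | X_SI | X_ID | X_SID) => true
  | LD, (X_D | X_SD | X_ID | X_SID) => true
  | _, _ => false
  end.

Section XModels.
Context {AG : finType} {AP ST : Type}.

Definition am_has (M : action_model AG AP ST) (l : letter) : Prop :=
  match l with
  | LS => am_serial M
  | LI => am_independent M
  | LD => am_deterministic M
  end.

Definition nm_has (N : nei_model AG AP ST) (l : letter) : Prop :=
  match l with
  | LS => nm_serial N
  | LI => nm_independent N
  | LD => nm_deterministic N
  end.

Definition am_X_model (X : ES) (M : action_model AG AP ST) : Prop :=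
  forall l, occurs l X -> am_has M l.

Definition nm_X_model (X : ES) (N : nei_model AG AP ST) : Prop :=
  forall l, occurs l X -> nm_has N l.

Definition z_representable (M : action_model AG AP ST)
    (N : nei_model AG AP ST) : Prop :=
  am_L M = nm_L N /\
  forall (C : {set AG}) (s : ST), am_AE M C s = nm_neiC N C s.

End XModels.

Definition class_z_representable (AG : finType) (AP : Type)
    (CM : forall ST : Type, action_model AG AP ST -> Prop)
    (CN : forall ST : Type, nei_model AG AP ST -> Prop) : Prop :=
  (forall (ST : Type) (M : action_model AG AP ST), CM ST M ->
     exists2 N : nei_model AG AP ST, CN ST N & z_representable M N) /\
  (forall (ST : Type) (N : nei_model AG AP ST), CN ST N ->
     exists2 M : action_model AG AP ST, CM ST M & z_representable M N).

Definition treelike_X_am (AG : finType) (AP : Type) (X : ES)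
    (ST : Type) (M : action_model AG AP ST) : Prop :=
  am_treelike M /\ am_X_model X M.

Definition treelike_X_nm (AG : finType) (AP : Type) (X : ES)
    (ST : Type) (N : nei_model AG AP ST) : Prop :=
  nm_treelike N /\ nm_X_model X N.

(* Main.v *)
(** In a tree-like action model the joint action leading from [s] to [t] is
    determined by [t], so the outcome sets of distinct joint actions are
    disjoint, and the outcome set of a coalition is the intersection of those of
    its members; hence the individual effectivity families already determine the
    coalitional ones. Conversely, from a neighborhood model take the
    neighborhoods themselves as actions, a joint action leading to the
    intersection of the chosen neighborhoods. In both cases the histories of the
    two models are related by translating moves one step at a time, which
    transfers tree-likeness. *)
Require Import Defs.
From mathcomp Require Import all_boot.
From mathcomp Require Import boolp classical_sets.

Local Open Scope classical_set_scope.

(** * Histories and their step-by-step translation *)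

Section Histories.
Context {T A B : Type}.
Variables (av : T -> set A) (res : T -> A -> set T).
Variables (av' : T -> set B) (res' : T -> B -> set T).

Lemma history_rcons {s t t' : T} {h : seq (A * T)} {x : A} :
  history av res s h t -> av t x -> res t x t' ->
  history av res s (rcons h (x, t')) t'.
Proof.
by elim: h s => [s /= -> //|[y u] h IH] s [avy resy hh] avx resx; split=> //; exact: IH.
Qed.

Fixpoint translate (F : T -> A -> B) (s : T) (h : seq (A * T)) : seq (B * T) :=
  if h is (x, t) :: h' then (F s x, t) :: translate F t h' else [::].

Variable F : T -> A -> B.

Lemma history_translate :
  (forall s x t, av s x -> res s x t -> av' s (F s x) /\ res' s (F s x) t) ->
  forall s h t, history av res s h t -> history av' res' s (translate F s h) t.
Proof.
move=> step s h t; elim: h s => [|[x u] h IH] s //= [avx resx hh].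
by have [avF resF] := step _ _ _ avx resx; split=> //; exact: IH.
Qed.

(** The move [x] may depend on the state [t] reached and not only on [y]; both constructions exploit
    this to pick a joint action that really leads to [t]. *)
Lemma history_lift :
  (forall s y t, av' s y -> res' s y t ->
     exists x, [/\ av s x, res s x t & y = F s x]) ->
  forall s h' t, history av' res' s h' t ->
  exists2 h, history av res s h t & h' = translate F s h.
Proof.
move=> step s h' t; elim: h' s => [|[y u] h' IH] s /=; first by exists [::].
move=> [avy resy /IH[h hh ->]].
have [x [avx resx ->]] := step _ _ _ avy resy.
by exists ((x, u) :: h).
Qed.

End Histories.

(** One translation may forget most of a move, but the whole family separates moves. The index [i0]
    makes the family nonempty, so that lengths and visited states can be compared. *)
Lemma translate_inj {T A B I : Type} (F : I -> A -> B) (i0 : I) :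
  (forall x y, (forall i, F i x = F i y) -> x = y) ->
  forall (s : T) (h1 h2 : seq (A * T)),
  (forall i, translate (fun=> F i) s h1 = translate (fun=> F i) s h2) ->
  h1 = h2.
Proof.
move=> inj s h1; elim: h1 s => [|[x u] h1 IH] s [|[y v] h2] //= E;
  do ?by have := E i0.
have -> : x = y by apply: inj => i; case: (E i).
have uv : u = v by case: (E i0).
by subst v; congr cons; apply: (IH u) => i; case: (E i).
Qed.

(** * Joint actions as families of individual actions *)

Section JointActions.
Context {AG : finType} {AC : Type}.
Implicit Types (f g : JAG AG AC) (C D : {set AG}).

Definition act f (a : AG) : AC := f (exist _ a (finset.in_setT a)).

Definition jact (F : AG -> AC) : JAG AG AC := fun a => F (val a).

Lemma actP f g : (forall a, act f a = act g a) -> f = g.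
Proof.
move=> fg; apply/funext => -[a aT].
have -> : aT = finset.in_setT a by exact: bool_irrelevance.
exact: fg.
Qed.

Lemma restrT f : restr [set: AG]%SET f = f.
Proof. by apply: actP => a. Qed.

Lemma restr_eqP C f g :
  restr C f = restr C g <-> forall a, a \in C -> act f a = act g a.
Proof.
split=> [E a aC|E]; last by apply/funext => a; exact: E (valP a).
by have /(congr1 (fun k => k (exist _ a aC))) := E.
Qed.

Lemma ja_union_restrP C D (sC : JA AC C) (sD : JA AC D) f :
  [disjoint C & D]%B ->
  ja_union sC sD = restr (C :|: D)%SET f <-> sC = restr C f /\ sD = restr D f.
Proof.
move=> dCD; split=> [E|[-> ->]]; last first.
  by apply/funext => a; rewrite /ja_union; destruct (@idP (val a \in C)).
split; apply/funext => -[a aX].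
  have aCD : a \in (C :|: D)%SET by rewrite inE aX.
  have /(congr1 (fun k => k (exist _ a aCD))) := E.
  rewrite /ja_union /=; destruct (@idP (a \in C)) as [aC|] => //.
  by have -> : aC = aX by exact: bool_irrelevance.
have aCD : a \in (C :|: D)%SET by rewrite inE aX orbT.
have /(congr1 (fun k => k (exist _ a aCD))) := E.
(* Disjointness rules out the left-biased branch for a member of [D]. *)
rewrite /ja_union /=; destruct (@idP (a \in C)) as [aC|aNC].
  by have := disjointFr dCD aC; rewrite aX.
by set aD := in_setU_r _ _; have -> : aD = aX by exact: bool_irrelevance.
Qed.

End JointActions.

(** * Outcomes and effectivity in action models *)

Section ActionModels.
Context {AG : finType} {AP ST : Type}.
Variable M : action_model AG AP ST.
Implicit Types (C D : {set AG}) (s t : ST) (f g : JAG AG (am_AC M)).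

Lemma am_out_restrP C s f t :
  am_out s (restr C f) t <->
  exists2 g, am_outAG s g t & forall a, a \in C -> act g a = act f a.
Proof.
split=> [[g /= /restr_eqP E gt]|[g gt E]]; exists g => //.
  by move=> a aC; rewrite E.
by apply/restr_eqP => a aC; rewrite E.
Qed.

Lemma am_outT s f : am_out s (f : JA _ [set: AG]%SET) = am_outAG s f.
Proof.
apply/seteqP; split=> t; first by case=> g /=; rewrite restrT => ->.
by exists f => //=; rewrite restrT.
Qed.

Lemma am_avT s f t : am_outAG s f t -> am_av (C := [set: AG]%SET) s f.
Proof. by move=> ft; exists t; rewrite am_outT. Qed.

(** A point of the outcome set of [sC] comes with a full joint action extending [sC], so full joint
    actions suffice to describe effectivity. *)
Lemma am_AEP C s Y :
  am_AE M C s Y <-> Y !=set0 /\ exists f, Y = am_out s (restr C f).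
Proof.
split=> [[sC avC <-]|[Y0 [f E]]]; last by exists (restr C f) => //; rewrite /am_av /= -E.
by split=> //; case: avC => t [f /= -> _]; exists f.
Qed.

Definition outAG_disjoint : Prop :=
  forall s f g t, am_outAG s f t -> am_outAG s g t -> f = g.

(** Appending either move to the history from the root to [s] gives a history to [t]; by uniqueness
    the two coincide, hence so do their last moves. *)
Lemma treelike_outAG_disjoint : am_treelike M -> outAG_disjoint.
Proof.
move=> [r rP] s f g t ft gt.
have [h [hs _]] := rP s; have [k [_ kP]] := rP t.
have Ef := kP _ (history_rcons _ _ hs (am_avT _ _ _ ft) ft).
have := kP _ (history_rcons _ _ hs (am_avT _ _ _ gt) gt).
by rewrite Ef => /rcons_inj[].
Qed.

End ActionModels.

(** * Transfer of seriality, independence and determinism *)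

Section Properties.
Context {AG : finType} {AP ST : Type}.
Variables (M : action_model AG AP ST) (N : nei_model AG AP ST).
Hypothesis MN : forall C s, am_AE M C s = nm_neiC N C s.
Hypothesis disjM : outAG_disjoint M.

Lemma serial_transfer : am_serial M <-> nm_serial N.
Proof.
split=> H C s; have := H C s; rewrite -?MN.
  by case=> sC avC; exists (am_out s sC); exists sC.
by case=> Y [sC avC _]; exists sC.
Qed.

Lemma independent_transfer : am_independent M <-> nm_independent N.
Proof.
split=> [H s C D dCD Y1 Y2|H s C D dCD sC sD avC avD].
  rewrite -!MN => -[sC avC <-] [sD avD <-].
  have [t [f /= /(ja_union_restrP _ _ _ _ _ dCD)[EC ED] ft]] := H s C D dCD _ _ avC avD.
  by exists t; split; exists f.
have [||t [[f /= EC ft] [g /= ED gt]]] := H s C D dCD (am_out s sC) (am_out s sD).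
- by rewrite -MN; exists sC.
- by rewrite -MN; exists sD.
(* The joint actions [f] and [g] both lead to [t], so they are equal and extend [sC] and [sD] at
   once. *)
exists t; exists f => //=; apply/(ja_union_restrP _ _ _ _ _ dCD); split=> //.
by rewrite (disjM _ _ _ _ ft gt).
Qed.

Lemma deterministic_transfer : am_deterministic M <-> nm_deterministic N.
Proof.
split=> [H s Y|H s f avf].
  by rewrite -MN => -[f avf <-]; rewrite am_outT; exact: H.
by rewrite -am_outT; apply: (H s); rewrite -MN; exists f.
Qed.

Lemma X_model_transfer (X : ES) : am_X_model X M <-> nm_X_model X N.
Proof.
have E l : am_has M l <-> nm_has N l.
  case: l; [exact: serial_transfer|exact: independent_transfer|].
  exact: deterministic_transfer.
by split=> H l /H /E.
Qed.

End Properties.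

(** A member of the iterated product amounts to one chosen set per index. Since [s] is
    duplicate-free, the choice can be a function of the index. Induction from the right follows
    [foldl]. *)
Lemma bigodotP {I : eqType} {T : Type} (D : I -> set (set T)) (s : seq I)
    (Y : set T) :
  (forall i, ~ D i set0) -> uniq s -> s != [::] ->
  bigodot [seq D i | i <- s] Y <->
  Y !=set0 /\ exists F : I -> set T,
    (forall i, i \in s -> D i (F i)) /\ Y = [set x | forall i, i \in s -> F i x].
Proof.
move=> D0; elim/last_ind: s Y => // s i IH Y + _.
rewrite rcons_uniq => /andP[iNs us].
case: s => [|j s] in IH iNs us *.
  rewrite /=; split=> [DY|[_ [F [DF E]]]].
    split; first by apply/set0P/eqP => Y0; apply: (D0 i); rewrite -Y0.
    exists (fun=> Y); split=> [k|]; first by rewrite inE => /eqP->.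
    apply/seteqP; split=> x /= Yx; first by [].
    by apply: (Yx i); rewrite inE.
  have -> : Y = F i; last by apply: DF; rewrite inE.
  rewrite E; apply/seteqP; split=> x /= Fx; first by apply: Fx; rewrite inE.
  by move=> k; rewrite inE => /eqP->.
have {}IH Z := IH Z us isT.
have -> : bigodot [seq D k | k <- rcons (j :: s) i] =
    odot (bigodot [seq D k | k <- j :: s]) (D i).
  by rewrite map_rcons /= foldl_rcons.
move: {j s}(j :: s) => s in IH iNs us *.
split=> [[Y0 [Y1 [Y2 [/IH[_ [F [DF E1]]] D2 E]]]]|[Y0 [F [DF E]]]].
  (* As [i] does not occur in [s], overriding the choice at [i] leaves the earlier ones intact. *)
  split=> //; exists (fun k => if k == i then Y2 else F k); split=> [k|].
    by rewrite mem_rcons inE; case: eqP => [->|_ /=] //; exact: DF.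
  rewrite E E1; apply/seteqP; split=> x /=.
    by move=> [F1 x2] k; rewrite mem_rcons inE; case: eqP => //= _; exact: F1.
  move=> H; split=> [k ks|].
    have := H k; rewrite mem_rcons inE ks orbT; case: eqP => [ki|_]; last exact.
    by move: iNs; rewrite -ki ks.
  by have := H i; rewrite mem_rcons inE eqxx; exact.
have EY : Y = [set x | forall k, k \in s -> F k x] `&` F i.
  rewrite E; apply/seteqP; split=> x /=.
    move=> H; split=> [k ks|]; apply: H; rewrite mem_rcons inE ?eqxx //.
    by rewrite ks orbT.
  by move=> [H1 H2] k; rewrite mem_rcons inE => /orP[/eqP->|/H1].
split=> //; exists [set x | forall k, k \in s -> F k x], (F i); split=> //; last first.
  by apply: DF; rewrite mem_rcons inE eqxx.
apply/IH; split; first by case: Y0 => x; rewrite EY => -[]; exists x.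
by exists F; split=> // k ks; apply: DF; rewrite mem_rcons inE ks orbT.
Qed.

(** * Coalitional neighborhoods as intersections of individual choices *)

Section NeighborhoodModels.
Context {AG : finType} {AP ST : Type}.
Variable N : nei_model AG AP ST.
Implicit Types (C : {set AG}) (s t : ST) (Y : set ST).

Lemma nei_sub_suc a s Y : nm_nei N a s Y -> Y `<=` nm_suc N s.
Proof. by move=> aY t Yt; rewrite -(nm_cover N a); exists Y. Qed.

(** Serves to complete the choices of a coalition by neighborhoods of the other agents around a
    given successor. *)
Lemma suc_nei s t : nm_suc N s t ->
  exists F : AG -> set ST, forall a, nm_nei N a s (F a) /\ F a t.
Proof.
move=> st; suff /choice[F FP] : forall a, exists Y, nm_nei N a s Y /\ Y t.
  by exists F.
by move=> a; move: st; rewrite -(nm_cover N a) => -[Y aY Yt]; exists Y.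
Qed.

(* The intersection with [nm_suc N s] only matters for the empty coalition. *)
Lemma nm_neiCP C s Y :
  nm_neiC N C s Y <->
  Y !=set0 /\ exists F : AG -> set ST,
    (forall a, a \in C -> nm_nei N a s (F a)) /\
    Y = nm_suc N s `&` [set t | forall a, a \in C -> F a t].
Proof.
rewrite /nm_neiC; case: asboolP => [s0|/eqP/set0P s0].
  by split=> // -[[t Yt] [F [_ E]]]; move: Yt; rewrite E s0 => -[].
case: eqP => [->|/eqP C0].
  split=> [->|[_ [F [_ ->]]]].
    split=> //; exists (fun=> setT); split=> [a|]; first by rewrite inE.
    by apply/seteqP; split=> [t st|t []].
  by apply/seteqP; split=> [t []//|t st]; split=> // a; rewrite inE.
have eC0 : enum C != [::].
  by apply: contra C0 => /eqP eC; apply/eqP/setP => a; rewrite -mem_enum eC !inE.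
apply: (iff_trans (bigodotP _ _ _ (fun a => @nm_nei_neq0 _ _ _ N a s) (enum_uniq _) eC0)).
have EF (F : AG -> set ST) : (forall a, a \in C -> nm_nei N a s (F a)) ->
    [set t | forall a, a \in enum C -> F a t] =
    nm_suc N s `&` [set t | forall a, a \in C -> F a t].
  move=> DF; apply/seteqP; split=> t /= Ft; last first.
    by move=> a; rewrite mem_enum; apply: Ft.2.
  have {}Ft a : a \in C -> F a t by move=> aC; apply: Ft; rewrite mem_enum.
  split=> //; have /set0Pn[a aC] := C0.
  exact: nei_sub_suc (DF a aC) _ (Ft a aC).
split=> -[Y0 [F [DF E]]]; split=> //; exists F.
  have {}DF a : a \in C -> nm_nei N a s (F a).
    by move=> aC; apply: DF; rewrite mem_enum.
  by rewrite -EF.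
by rewrite EF //; split=> // a; rewrite mem_enum; exact: DF.
Qed.

Lemma nm_neiC1 a s : nm_neiC N [set a]%SET s = nm_nei N a s.
Proof.
apply/seteqP; split=> Y.
  move=> /nm_neiCP[_ [F [DF ->]]].
  have aF : nm_nei N a s (F a) by apply: DF; rewrite inE.
  rewrite (_ : _ `&` _ = F a) //; apply/seteqP; split=> [t [_]|t Ft].
    by apply; rewrite inE.
  split; first exact: nei_sub_suc aF _ Ft.
  by move=> b; rewrite inE => /eqP->.
move=> aY; apply/nm_neiCP; split.
  by apply/set0P/eqP => Y0; apply: (@nm_nei_neq0 _ _ _ N a s); rewrite -Y0.
exists (fun=> Y); split=> [b|]; first by rewrite inE => /eqP->.
apply/seteqP; split=> [t Yt|t [_]]; last by apply; rewrite inE.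
by split=> //; exact: nei_sub_suc aY _ Yt.
Qed.

End NeighborhoodModels.

(** * From action models to neighborhood models *)

Section ActionToNeighborhood.
Context {AG : finType} {AP ST : Type}.
Variable M : action_model AG AP ST.

Let suc (s : ST) : set ST := \bigcup_f am_outAG (a := M) s f.

Lemma AE1_cover a s : \bigcup_(Y in am_AE M [set a]%SET s) Y = suc s.
Proof.
apply/seteqP; split=> t; first by case=> Y [sC _ <-] [f _ ft]; exists f.
move=> [f _ ft]; have ot : am_out s (restr [set a]%SET f) t by exists f.
by exists (am_out s (restr [set a]%SET f)) => //; apply/am_AEP; split; [exists t|exists f].
Qed.

Lemma AE1_neq0 a s : ~ am_AE M [set a]%SET s set0.
Proof. by move=> /am_AEP[[]]. Qed.

Definition nei_of_action : nei_model AG AP ST :=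
  NeiModel (am_ST_nonempty M) (@am_L _ _ _ M) AE1_cover AE1_neq0.

Hypothesis disjM : outAG_disjoint M.

Lemma nei_of_action_neiC C s : am_AE M C s = nm_neiC nei_of_action C s.
Proof.
(* For the inclusion from right to left, the joint action [g] leading to [t] equals, by
   disjointness, the one witnessing each agent's condition, so it agrees with [f] on all of [C]. *)
have outE (f : JAG AG (am_AC M)) : am_out s (restr C f) = suc s `&`
    [set t | forall a, a \in C -> am_out s (restr [set a]%SET f) t].
  apply/seteqP; split=> t.
    move=> /am_out_restrP[g gt gf]; split; first by exists g.
    move=> a aC; apply/am_out_restrP; exists g => // b.
    by rewrite inE => /eqP->; exact: gf.
  move=> [[g _ gt] gf]; apply/am_out_restrP; exists g => // a aC.
  have /am_out_restrP[k kt kf] := gf a aC.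
  by rewrite (disjM _ _ _ _ gt kt); apply: kf; rewrite inE.
apply/seteqP; split=> Y.
  move=> /am_AEP[[t Yt] [f E]]; apply/nm_neiCP; split; first by exists t.
  exists (fun a => am_out s (restr [set a]%SET f)); split; last by rewrite E outE.
  move=> a aC; apply/am_AEP; split; last by exists f.
  by exists t; move: Yt; rewrite E outE => -[_]; exact.
move=> /nm_neiCP[[t Yt] [F [DF E]]]; apply/am_AEP; split; first by exists t.
(* The agents' sets [F a] come from unrelated joint actions; the one joint action [g] leading to the
   common point [t] has the right component for every agent of [C]. *)
have [[g _ gt] Ft] : (suc s `&` [set t | forall a, a \in C -> F a t]) t.
  by move: Yt; rewrite E.
exists g; rewrite outE E; congr (_ `&` _).
suff EF a : a \in C -> F a = am_out s (restr [set a]%SET g).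
  by apply/seteqP; split=> u H a aC; have := H a aC; rewrite EF.
move=> aC; have /am_AEP[_ [k Ek]] := DF a aC; rewrite Ek; congr am_out.
apply/restr_eqP => b; rewrite inE => /eqP->.
have := Ft a aC; rewrite Ek => /am_out_restrP[l lt lk].
by rewrite (disjM _ _ _ _ gt lt) lk // inE.
Qed.

Lemma nei_of_action_treelike : am_treelike M -> nm_treelike nei_of_action.
Proof.
move=> [r rP]; exists r => a t; have [h [hh hP]] := rP t.
pose F s f := am_out s (restr [set a]%SET (f : JAG AG (am_AC M))).
exists (translate F r h); split.
  apply: history_translate hh => s f u _ fu.
  have Fu : F s f u by apply/am_out_restrP; exists f.
  by split=> //; rewrite nm_neiC1; apply/am_AEP; split; [exists u|exists f].
(* The action [f] giving [Y] need not lead to [u]; it is replaced by some [g] that does and has the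
   same component at [a]. *)
have lift s Y u : nm_neiC nei_of_action [set a]%SET s Y -> Y u ->
    exists f, [/\ am_av (M := M) (C := [set: AG]%SET) s f,
                  am_outAG (a := M) s f u & Y = F s f].
  rewrite nm_neiC1 => /am_AEP[_ [f ->]] /am_out_restrP[g gu gf].
  exists g; split=> //; first exact: am_avT gu.
  by congr am_out; apply/restr_eqP => b /gf.
move=> h' hh'; have [k hk ->] := history_lift _ _ _ _ F lift _ _ _ hh'.
by rewrite (hP k hk).
Qed.

End ActionToNeighborhood.

(** * From neighborhood models to action models *)

Section NeighborhoodToAction.
Context {AG : finType} {AP ST : Type}.
Variable N : nei_model AG AP ST.

(** All agents and states share one type of actions, so arbitrary sets are actions; a joint action
    with a component that is not a neighborhood gets an empty outcome. *)
Definition action_of_nei : action_model AG AP ST :=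
  @ActionModel AG AP ST (set ST) (nm_ST_nonempty N) (inhabits set0)
    (fun s f => [set t | forall a, nm_nei N a s (act f a) /\ act f a t])
    (@nm_L _ _ _ N).

Hypothesis hAG : 0 < #|AG|.

Lemma action_of_nei_neiC C s : am_AE action_of_nei C s = nm_neiC N C s.
Proof.
have [a0 _] := card_gt0P hAG.
have outE f : (forall a, a \in C -> nm_nei N a s (act f a)) ->
    am_out (M := action_of_nei) s (restr C f) =
    nm_suc N s `&` [set t | forall a, a \in C -> act f a t].
  move=> nf; apply/seteqP; split=> t.
    move=> /am_out_restrP[g gt gf]; split.
      (* The agent [a0] puts [t] among the successors even when [C] is empty. *)
      by have [ng tg] := gt a0; exact: nei_sub_suc ng _ tg.
    by move=> a aC; rewrite -gf //; case: (gt a).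
  move=> [st ft]; apply/am_out_restrP; have [F FP] := suc_nei _ _ _ st.
  exists (jact (fun a => if a \in C then act f a else F a)).
    by move=> a; rewrite /jact /act /=; case: ifP => // aC; split; [exact: nf|exact: ft].
  by move=> a aC; rewrite /jact /act /= aC.
apply/seteqP; split=> Y.
  move=> /am_AEP[[t Yt] [f E]]; apply/nm_neiCP; split; first by exists t.
  have nf a : a \in C -> nm_nei N a s (act f a).
    move=> aC; move: Yt; rewrite E => /am_out_restrP[g gt gf].
    by rewrite -gf //; case: (gt a).
  by exists (act f); split=> //; rewrite E outE.
move=> /nm_neiCP[Y0 [F [DF E]]]; apply/am_AEP; split=> //.
by exists (jact F); rewrite outE.
Qed.

Lemma action_of_nei_treelike : nm_treelike N -> am_treelike action_of_nei.
Proof.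
have [a0 _] := card_gt0P hAG.
move=> [r rP]; exists r => t; have [h [hh _]] := rP a0 t.
pose step : ST -> set (JAG AG (set ST)) := am_av (M := action_of_nei) (C := [set: AG]%SET).
have lift s Y u : nm_neiC N [set a0]%SET s Y -> Y u ->
    exists f, [/\ step s f, am_outAG (a := action_of_nei) s f u & Y = act f a0].
  rewrite nm_neiC1 => nY Yu.
  have [F FP] := suc_nei _ _ _ (nei_sub_suc _ _ _ _ nY _ Yu).
  pose f : JAG AG (set ST) := jact (fun a => if a == a0 then Y else F a).
  have fu : am_outAG (a := action_of_nei) s f u.
    by move=> a; rewrite /f /jact /act /=; case: eqP => // ->.
  exists f; split=> //; first exact: am_avT fu.
  by rewrite /f /jact /act /= eqxx.
have [k hk _] := history_lift _ _ _ _ (fun=> act^~ a0) lift _ _ _ hh.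
exists k; split=> // k' hk'.
(* For each agent, [k] and [k'] project to the same unique history of that agent, so they agree in
   every component. *)
apply: (translate_inj (fun a => act^~ a) a0 _ r) => [f g|a]; first exact: actP.
have [m [_ mP]] := rP a t.
have P l : am_history (M := action_of_nei) r l t ->
    m = translate (fun=> act^~ a) r l.
  move=> hl; apply: mP; apply: history_translate hl => s f u _ fu.
  by rewrite nm_neiC1; exact: fu.
by rewrite -!P.
Qed.

End NeighborhoodToAction.

Theorem theorem6p11 (AG : finType) (hAG : 0 < #|AG|) (AP : countType) (X : ES) :
  class_z_representable (@treelike_X_am AG AP X) (@treelike_X_nm AG AP X).
Proof.
split=> ST.
  move=> M [treeM XM]; have disjM := treelike_outAG_disjoint _ treeM.
  have MN := nei_of_action_neiC _ disjM.
  exists (nei_of_action M); last by split.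
  by split; [exact: nei_of_action_treelike|exact/(X_model_transfer _ _ MN disjM)].
move=> N [treeN XN]; have MN := action_of_nei_neiC N hAG.
(* Tree-likeness comes first: it yields the disjointness used to transfer the properties. *)
have treeM := action_of_nei_treelike N hAG treeN.
exists (action_of_nei N); last by split.
split=> //; apply/(X_model_transfer _ _ MN) => //.
exact: treelike_outAG_disjoint.
Qed.
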